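(* Let $n\ge1$ and let $\tilde f_n\in\mathcal{MA}_n$ be $$\tilde f_n(T,U)=T^{n+1}-\zeta_1T^nU+\zeta_2T^{n-1}U^2+\cdots+(-1)^n\zeta_nTU^n+(-1)^{n+1}U^{n+1},$$ with $\zeta_j\in\mathbb{C}$ and $\zeta_j=\overline{\zeta_{n+1-j}}$ for $j=1,\dots,n$. Let $$\tilde g_n(X,Y)=\tilde f_n\big(i(X+iY),\,i(X-iY)\big)=\sum_{j=0}^{n+1}c_jX^{n+1-j}Y^j,\qquad c_j\in\mathbb{R},$$ and assume $c_0\neq0$. Then $$\mathrm{Dis}(\tilde g_n(X,1))=2^{n(n+1)}\det H_n.$$
   Context: $\mathcal{MA}_n$ denotes the set of forms $\sum_{k=0}^{n+1}(-1)^k\zeta_kT^{n+1-k}U^k$ with $\zeta_k\in\mathbb{C}$, $\zeta_k=\overline{\zeta_{n+1-k}}$ for $0\le k\le n+1$, and $\zeta_0=\zeta_{n+1}=1$. For such a form the substitution $T=i(X+iY)$, $U=i(X-iY)$ yields a form with real coefficients. Discriminant: with $x_1,\dots,x_{n+1}$ the complex roots (with multiplicity) of $\tilde g_n(X,1)$ (which has degree $n+1$ since $c_0\ne0$), $$\mathrm{Dis}(\tilde g_n(X,1))=c_0^{2n}\prod_{1\le j<k\le n+1}(x_j-x_k)^2 .$$ Matrix $H_n$: let $t_1,\dots,t_{n+1}\in\mathbb{C}$ be the roots (with multiplicity) of $\tilde f_n(T,1)$, so that $\zeta_j$ is the $j$-th elementary symmetric function of $t_1,\dots,t_{n+1}$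 and $t_1t_2\cdots t_{n+1}=1$. For $m\in\mathbb{Z}$ put $h_m=h_m(\zeta_1,\dots,\zeta_n)=\sum_{j=1}^{n+1}t_j^m$ (a polynomial in $\zeta_1,\dots,\zeta_n$, also for $m<0$). Then $H_n$ is the $(n+1)\times(n+1)$ matrix whose entry in row $a$ and column $b$ ($0\le a,b\le n$) is $h_{a-b}$. *)

(* Defs.v *)
From mathcomp Require Export all_boot all_order all_algebra.
From mathcomp Require Export complex mpoly reals.
Set Implicit Arguments.
Unset Strict Implicit.
Unset Printing Implicit Defensive.
Import GRing.Theory Num.Theory.
Local Open Scope ring_scope.

(* ord0 and ord_max are the two variables: (T, U), respectively (X, Y). *)
Definition monom2 (C : nzRingType) (a b : nat) : {mpoly C[2]} :=
  'X_ord0 ^+ a * 'X_ord_max ^+ b.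

Definition binary_form (C : nzRingType) (d : nat) (c : 'I_d.+1 -> C) :
    {mpoly C[2]} :=
  \sum_(j < d.+1) c j *: monom2 C (d - j) j.

(* p(X, 1) *)
Definition dehomog (C : nzRingType) (p : {mpoly C[2]}) : {poly C} :=
  mmap polyC (tnth [tuple 'X; 1]) p.

(* Note that rev_ord k has value n + 1 - k for k : 'I_n.+2. *)
Definition MA (C : numClosedFieldType) (n : nat) (f : {mpoly C[2]}) : Prop :=
  exists zeta : 'I_n.+2 -> C,
    [/\ zeta ord0 = 1,
        zeta ord_max = 1,
        forall k, zeta k = Num.conj (zeta (rev_ord k))
      & f = binary_form (fun k => (-1) ^+ k * zeta k)].

(* p(i (X + i Y), i (X - i Y)) *)
Definition cayley (C : numClosedFieldType) (p : {mpoly C[2]}) : {mpoly C[2]} :=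
  p \mPo [tuple 'i *: ('X_ord0 + 'i *: 'X_ord_max);
                'i *: ('X_ord0 - 'i *: 'X_ord_max)].

(* The roots are listed with multiplicity, in an unspecified order. *)
Definition root_seq (C : closedFieldType) (p : {poly C}) : seq C :=
  sval (closed_field_poly_normal p).

(* The exponent (size p).-2.*2 is 2 (deg p - 1). *)
Definition Dis (C : closedFieldType) (p : {poly C}) : C :=
  let x := root_seq p in
  lead_coef p ^+ (size p).-2.*2 *
  \prod_(j < size x) \prod_(k < size x | (j < k)%N) (x`_j - x`_k) ^+ 2.

Definition power_sum (C : closedFieldType) (f : {mpoly C[2]}) (m : int) : C :=
  \sum_(t <- root_seq (dehomog f)) t ^ m.

Definition Hmx (C : closedFieldType) (n : nat) (f : {mpoly C[2]}) :
    'M[C]_n.+1 :=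
  \matrix_(a < n.+1, b < n.+1) power_sum f (a%:Z - b%:Z).

(* Main.v *)
(** Writing f = prod_j (T - t_j U), one gets
    f(i(X + i), i(X - i)) = prod_j (u_j X - (1 + t_j)) with u_j = i(1 - t_j), so
    the leading coefficient is prod_j u_j and the roots are x_j = (1 + t_j)/u_j.
    Since u_j u_k (x_j - x_k) = 2i(t_j - t_k), the discriminant equals
    prod_(j < k) -4 (t_j - t_k)^2.  The matrix H_n is the product of the
    Vandermonde matrix of the t_j and the transposed Vandermonde matrix of the
    1/t_j, and prod_(j < k) t_j t_k = (prod_j t_j)^n = 1.  The coefficients are
    real because conjugation exchanges zeta_k and zeta_(n+1-k), and i(X + iY)
    and -i(X - iY). *)
Require Import Defs.
From mathcomp Require Import ring.
Import GRing.Theory Num.Theory.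
Local Open Scope ring_scope.

(** * Binary forms under the substitution, and reality of the coefficients *)

Lemma monom2E (C : nzRingType) (a b : nat) :
  monom2 C a b = 'X_[(U_(ord0) *+ a + U_(ord_max) *+ b)%MM].
Proof. by rewrite mpolyXD -!mpolyXn. Qed.

(** Provides the coefficients of the transformed form from homogeneity alone, without expanding the
    substitution. *)
Lemma homog_binary_form (C : nzRingType) (d : nat) (p : {mpoly C[2]}) :
  p \is d.-homog ->
  p = binary_form
        (fun j : 'I_d.+1 => p@_(U_(ord0) *+ (d - j) + U_(ord_max) *+ j)%MM).
Proof.
move=> hp; apply/mpolyP => m; rewrite /binary_form raddf_sum /=.
have mE (a b : nat) : ((U_(ord0) *+ a + U_(ord_max) *+ b)%MM == m)
    = (a == m ord0) && (b == m ord_max).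
  apply/eqP/andP => [<-|[/eqP ea /eqP eb]].
    by rewrite !mnmDE !mulmnE !mnm1E /= !mul1n !mul0n addn0 add0n.
  apply/mnmP => i; rewrite mnmDE !mulmnE !mnm1E ea eb.
  by case: i => [[|[|//]] hi] /=; rewrite !(mul1n, mul0n) ?addn0 ?add0n;
    congr (m _); apply: val_inj.
have degm : mdeg m = (m ord0 + m ord_max)%N.
  by rewrite mdegE big_ord_recl big_ord1; congr (_ + m _)%N; apply: val_inj.
have [dm|dm] := eqVneq (mdeg m) d; last first.
  rewrite (dhomog_nemf_coeff hp) // big1 // => j _.
  rewrite mcoeffZ monom2E mcoeffX mE.
  case: andP => [[/eqP a /eqP b]|_]; last by rewrite mulr0.
  by rewrite degm -a -b subnK ?eqxx // -ltnS in dm.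
have mlt : (m ord_max < d.+1)%N by rewrite -dm degm ltnS leq_addl.
rewrite (bigD1 (Ordinal mlt)) //= big1 ?addr0.
  have e : (U_(ord0) *+ (d - m ord_max) + U_(ord_max) *+ m ord_max)%MM = m.
    by apply/eqP; rewrite mE -dm degm addnK !eqxx.
  by rewrite mcoeffZ monom2E mcoeffX e eqxx mulr1.
move=> j jm; rewrite mcoeffZ monom2E mcoeffX mE.
suff /negPf -> : nat_of_ord j != m ord_max by rewrite andbF mulr0.
by apply: contraNneq jm => e; apply/eqP/val_inj.
Qed.

Lemma cayley_binary_form (C : numClosedFieldType) (d : nat) (c : 'I_d.+1 -> C) :
  cayley (binary_form c) =
  \sum_(j < d.+1) c j *:
    (('i *: ('X_ord0 + 'i *: 'X_ord_max)) ^+ (d - j) *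
     ('i *: ('X_ord0 - 'i *: 'X_ord_max)) ^+ j).
Proof.
rewrite /cayley /binary_form raddf_sum; apply: eq_bigr => j _ /=.
by rewrite comp_mpolyZ rmorphM !rmorphXn /= !comp_mpolyXU.
Qed.

Lemma cayley_homog (C : numClosedFieldType) (d : nat) (c : 'I_d.+1 -> C) :
  cayley (binary_form c) \is d.-homog.
Proof.
have homX i : ('X_i : {mpoly C[2]}) \is 1.-homog by rewrite dhomogX /= mdeg1.
have homXn (p : {mpoly C[2]}) k : p \is 1.-homog -> p ^+ k \is k.-homog.
  by move=> hp; have := dhomogMn k hp; rewrite mul1n.
rewrite cayley_binary_form; apply: rpred_sum => j _; apply: rpredZ.
suff: ('i *: ('X_ord0 + 'i *: 'X_ord_max) : {mpoly C[2]}) ^+ (d - j) *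
     ('i *: ('X_ord0 - 'i *: 'X_ord_max)) ^+ j \is (d - j + j).-homog.
  by rewrite subnK // -ltnS.
by apply: dhomogM; apply: homXn; rewrite rpredZ // rpredD ?rpredN ?rpredZ.
Qed.

Lemma cayley_MA_conj (C : numClosedFieldType) (n : nat) (f : {mpoly C[2]}) :
  MA n f -> map_mpoly Num.conj (cayley f) = cayley f.
Proof.
case=> zeta [_ _ hz ->]; rewrite cayley_binary_form raddf_sum /=.
set A := 'i *: ('X_ord0 + _); set B := 'i *: ('X_ord0 - _).
have mapZ (z : C) (p : {mpoly C[2]}) :
    map_mpoly Num.conj (z *: p) = Num.conj z *: map_mpoly Num.conj p.
  exact: map_mpolyZ.
have [hA hB] : map_mpoly Num.conj A = - B /\ map_mpoly Num.conj B = - A.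
  rewrite /A /B !mapZ conjCi rmorphD rmorphB /= !mapZ conjCi !map_mpolyX.
  by rewrite !scaleNr opprK.
(* Conjugation swaps [A] and [B] up to sign, so term k on the left matches term n + 1 - k on the
   right. *)
rewrite [RHS](reindex_inj rev_ord_inj) /=; apply: eq_bigr => k _.
have kn : (k <= n.+1)%N by rewrite -ltnS.
rewrite mapZ !rmorphM !rmorphXn /= rmorphN1 hA hB [zeta (rev_ord k)]hz.
rewrite rev_ordK /= !subSS subKn // -(scaleN1r A) -(scaleN1r B) !exprZn.
rewrite -scalerAl -scalerAr !scalerA [X in _ *: X = _]mulrC; congr (_ *: _).
(* The sign of the coefficient cancels the one from (-A)^k; the one from (-B)^(n+1-k) is the sign on
   the right. *)
have ee : (-1) ^+ k * (-1) ^+ k = 1 :> C by rewrite -expr2 sqrr_sign.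
by rewrite [LHS]mulrC mulrA mulrA ee mul1r mulrC.
Qed.

(** * Dehomogenization and factorization into linear factors *)

Lemma dehomog_binary_form (C : comNzRingType) (d : nat) (c : 'I_d.+1 -> C) :
  dehomog (binary_form c) = \sum_(j < d.+1) c j *: 'X^(d - j).
Proof.
rewrite /dehomog raddf_sum; apply: eq_bigr => j _ /=.
rewrite mmapZ rmorphM !rmorphXn /= !mmapX !mmap1U /= !(tnth_nth 0) /=.
by rewrite expr1n mulr1 mul_polyC.
Qed.

Lemma coef_dehomog_binary_form (C : comNzRingType) (d : nat)
    (c : 'I_d.+1 -> C) (j : 'I_d.+1) :
  (dehomog (binary_form c))`_(d - j) = c j.
Proof.
rewrite dehomog_binary_form coef_sum (bigD1 j) //= coefZ coefXn eqxx mulr1.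
rewrite big1 ?addr0 // => k kj; rewrite coefZ coefXn.
suff /negPf -> : (d - j != d - k)%N by rewrite mulr0.
apply: contraNneq kj => e; apply/eqP/val_inj => /=.
by rewrite -(subKn (ltn_ord k : (k <= d)%N)) -e subKn // -ltnS.
Qed.

Lemma size_dehomog_binary_form (C : comNzRingType) (d : nat)
    (c : 'I_d.+1 -> C) :
  (size (dehomog (binary_form c)) <= d.+1)%N.
Proof.
rewrite dehomog_binary_form; apply: (leq_trans (size_sum _ _ _)).
apply/bigmax_leqP => j _; apply: (leq_trans (size_scale_leq _ _)).
by rewrite size_polyXn ltnS leq_subr.
Qed.

(** Induction on [s]: in a new factor 'X - t, the 'X shifts the coefficients, which produces [a],
    and the t scales them, which produces [t *: b]. No division by [b] occurs. *)
Lemma homogenize_prod_XsubC (C : comNzRingType) (a b : {poly C}) (s : seq C) :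
  \sum_(k < (size s).+1)
    (\prod_(t <- s) ('X - t%:P))`_k *: (a ^+ k * b ^+ (size s - k)) =
  \prod_(t <- s) (a - t *: b).
Proof.
elim: s => [|t s IHs] /=.
  by rewrite !big_nil big_ord1 coef1 !expr0 mulr1 scale1r.
rewrite !big_cons -IHs !mulrBl !big_distrr /=.
set q := \prod_(t <- s) _.
have sq : q`_(size s).+1 = 0 by rewrite nth_default // size_prod_XsubC.
under eq_bigr => k _ do rewrite coefB coefXM coefCM scalerBl.
rewrite sumrB; congr (_ - _).
  rewrite big_ord_recl /= scale0r add0r; apply: eq_bigr => k _.
  by rewrite /bump /= add1n subSS exprS -mulrA scalerAr.
rewrite big_ord_recr /= sq mulr0 scale0r addr0; apply: eq_bigr => k _.
rewrite -scalerAl -!scalerAr scalerA; congr (_ *: _).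
by rewrite subSn -1?ltnS // exprS mulrCA.
Qed.

Lemma dehomog_cayley (C : numClosedFieldType) (d : nat) (c : 'I_d.+1 -> C)
    (s : seq C) :
  size s = d -> dehomog (binary_form c) = \prod_(t <- s) ('X - t%:P) ->
  dehomog (cayley (binary_form c)) =
  \prod_(t <- s) (('i * (1 - t)) *: 'X - (1 + t)%:P).
Proof.
move=> sz hf; rewrite cayley_binary_form [LHS]raddf_sum /=.
pose A : {poly C} := 'i *: ('X + 'i%:P).
pose B : {poly C} := 'i *: ('X - 'i%:P).
transitivity (\prod_(t <- s) (A - t *: B)); last first.
  apply: eq_bigr => t _; rewrite /A /B -!mul_polyC.
  rewrite !(rmorphM, rmorphB, rmorphD) /=.
  have ii : 'i%:P * 'i%:P = -1 :> {poly C}.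
    by rewrite -rmorphM -expr2 sqrCi rmorphN1.
  ring: ii.
(* The homogenized product is indexed by the power of T, the binary form by that of U; hence the
   reversal. *)
rewrite -homogenize_prod_XsubC -hf sz (reindex_inj rev_ord_inj) /=.
apply: eq_bigr => j _; have jd : (j <= d)%N by rewrite -ltnS.
rewrite [LHS]mmapZ rmorphM !rmorphXn /= subSS subKn // mul_polyC.
rewrite -(coef_dehomog_binary_form _ _ c (rev_ord j)) /= subSS subKn //.
congr (_ *: (_ ^+ _ * _ ^+ _)).
  rewrite mmapZ rmorphD /= mmapZ !mmapX !mmap1U !(tnth_nth 0) /=.
  by rewrite mulr1 mul_polyC.
rewrite mmapZ rmorphB /= mmapZ !mmapX !mmap1U !(tnth_nth 0) /=.
by rewrite mulr1 mul_polyC.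
Qed.

(** * Products over pairs and the determinant of power sums *)

Lemma prod_pairs (R : comNzRingType) (n : nat) (F : 'I_n.+1 -> R) :
  \prod_(j < n.+1) \prod_(k < n.+1 | (j < k)%N) (F j * F k) =
  (\prod_j F j) ^+ n.
Proof.
transitivity (\prod_(j < n.+1) ((\prod_(k < n.+1 | (j < k)%N) F j) *
                       \prod_(k < n.+1 | (j < k)%N) F k)).
  by apply: eq_bigr => j _; rewrite big_split.
(* Each index lies in n pairs: as the smaller member or, after exchanging the products, as the
   larger one. *)
rewrite big_split /= [X in _ * X](exchange_big_dep xpredT) //= -big_split /=.
rewrite -prodrXl; apply: eq_bigr => j _.
have cn : #|predC1 j| = n by rewrite cardC1 card_ord.
rewrite -[X in _ ^+ X]cn -prodr_const
  [RHS](bigID (fun k : 'I_n.+1 => (j < k)%N)) /=.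
congr (_ * _); apply: eq_bigl => k; rewrite inE -val_eqE /=.
  by case: ltngtP.
by case: ltngtP.
Qed.

(** The permutation is read on indices instead of values. It serves to align the unordered roots of
    the transformed form with the t_j. *)
Lemma perm_map_lift (S T : eqType) (g : S -> T) (s : seq S) (x : seq T) :
  perm_eq x (map g s) -> exists2 s', x = map g s' & perm_eq s' s.
Proof.
case: s => [/perm_nilP ->|a s]; first by exists [::].
case/(perm_iotaP (g a)) => Is; rewrite size_map => pIs ->.
exists (map (nth a (a :: s)) Is); last first.
  by apply/(perm_iotaP a); exists Is.
rewrite -map_comp; apply/eq_in_map => i; rewrite (perm_mem pIs) mem_iota add0n.
by move=> /andP[_ hi]; rewrite (nth_map a).
Qed.

Lemma root_seq_XsubC (C : closedFieldType) (a : C) (s : seq C) :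
  a != 0 -> perm_eq (root_seq (a *: \prod_(t <- s) ('X - t%:P))) s.
Proof.
move=> a0; rewrite /root_seq; case: closed_field_poly_normal => r /= hr.
rewrite lead_coefZ lead_coef_prod_XsubC mulr1 in hr.
by apply/prod_XsubC_eq/(scalerI a0).
Qed.

Lemma det_power_sums (C : fieldType) (n : nat) (s : seq C) :
  size s = n.+1 -> \prod_(t <- s) t = 1 ->
  \det (\matrix_(a < n.+1, b < n.+1) \sum_(t <- s) t ^ (a%:Z - b%:Z)) =
  \prod_(j < n.+1) \prod_(k < n.+1 | (j < k)%N) - (s`_j - s`_k) ^+ 2.
Proof.
move=> sz s1.
have s0 (j : 'I_n.+1) : s`_j != 0.
  have : \prod_(t <- s) t != 0 by rewrite s1 oner_eq0.
  by rewrite prodf_seq_neq0 => /allP/(_ s`_j); apply; rewrite mem_nth ?sz.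
pose u : 'rV_n.+1 := \row_j s`_j; pose v : 'rV_n.+1 := \row_j (s`_j)^-1.
transitivity (\det (Vandermonde n.+1 u *m (Vandermonde n.+1 v)^T)).
  congr (\det _); apply/matrixP => a b; rewrite !mxE (big_nth 0) sz big_mkord.
  by apply: eq_bigr => j _; rewrite !mxE expfzDr // -exprnN exprVn.
rewrite det_mulmx det_tr !det_Vandermonde -big_split /=.
have p1 : \prod_(j < n.+1) \prod_(k < n.+1 | (j < k)%N) (s`_j * s`_k) = 1.
  rewrite (prod_pairs _ _ (fun j : 'I_n.+1 => s`_j)).
  by move: s1; rewrite (big_nth 0) sz big_mkord => ->; rewrite expr1n.
(* A pair contributes (s_k - s_j)(1/s_k - 1/s_j) = -(s_j - s_k)^2/(s_j s_k); inserting [p1] clears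
   the denominators. *)
rewrite -[LHS]mulr1 -[X in _ * X = _]p1 -big_split; apply: eq_bigr => j _ /=.
rewrite -!big_split; apply: eq_bigr => k _ /=; rewrite !mxE.
by field; rewrite !s0.
Qed.

(** * Roots, leading coefficient and discriminant of the transformed form *)

Lemma coef_prod_affine (C : comNzRingType) (a b : C -> C) (s : seq C) :
  (\prod_(t <- s) (a t *: 'X - (b t)%:P))`_(size s) = \prod_(t <- s) a t.
Proof.
(* The size bound is carried along so that the constant term of a new factor contributes nothing in
   top degree. *)
suff [] : (size (\prod_(t <- s) (a t *: 'X - (b t)%:P))%R <= (size s).+1)%N /\
  (\prod_(t <- s) (a t *: 'X - (b t)%:P))`_(size s) = \prod_(t <- s) a t by [].
elim: s => [|t s [IHsize IHcoef]]; first by rewrite !big_nil size_poly1 coef1.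
rewrite !big_cons; split.
  apply: (leq_trans (size_polyMleq _ _)).
  have h : (size (a t *: 'X - (b t)%:P)%R <= 2)%N.
    apply: (leq_trans (size_polyD _ _)); rewrite geq_max size_polyN.
    rewrite (leq_trans (size_scale_leq _ _)) ?size_polyX //.
    by rewrite (leq_trans (size_polyC_leq1 _)).
  by have := leq_add h IHsize; case: (_ + size _)%N.
by rewrite mulrBl -scalerAl coefB coefZ coefXM coefCM /= IHcoef
  [_`__.+1]nth_default ?mulr0 ?subr0.
Qed.

(** Here zeta_0 = 1 makes the polynomial monic of degree n + 1, and zeta_(n+1) = 1 makes its
    constant term (-1)^(n+1), which fixes the product of the roots. *)
Lemma MA_roots (C : numClosedFieldType) (n : nat) (f : {mpoly C[2]}) :
  MA n f ->
  let s := root_seq (dehomog f) in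
  [/\ dehomog f = \prod_(t <- s) ('X - t%:P), size s = n.+1
    & \prod_(t <- s) t = 1].
Proof.
case=> z [z0 z1 _ ->]; set c := fun k : 'I_n.+2 => (-1) ^+ k * z k.
rewrite /root_seq; case: closed_field_poly_normal => s /=.
have p0 : (dehomog (binary_form c))`_n.+1 = 1.
  by have := coef_dehomog_binary_form _ _ c ord0; rewrite subn0 /c z0 mulr1.
have p1 : (dehomog (binary_form c))`_0 = (-1) ^+ n.+1.
  by have := coef_dehomog_binary_form _ _ c ord_max;
    rewrite /= subnn /c z1 mulr1.
have sp : size (dehomog (binary_form c)) = n.+2.
  apply/eqP; rewrite eqn_leq size_dehomog_binary_form ltnNge.
  by apply/negP => /leq_sizeP/(_ _ (leqnn _))/eqP; rewrite p0 oner_eq0.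
rewrite lead_coefE sp p0 scale1r => hs.
have ss : size s = n.+1.
  by have := size_prod_XsubC s id; rewrite -hs sp => -[].
split=> //; move: p1; rewrite hs coef0_prod_XsubC ss -[RHS]mulr1.
by apply/mulfI; rewrite signr_eq0.
Qed.

Lemma Dis_cayley (C : numClosedFieldType) (n : nat) (f : {mpoly C[2]}) :
  MA n f -> (dehomog (cayley f))`_n.+1 != 0 ->
  Dis (dehomog (cayley f)) = 2 ^+ (n * n.+1) * \det (Hmx n f).
Proof.
move=> hf; have [hs ss s1] := MA_roots _ _ _ hf.
rewrite /Hmx /power_sum; move: (root_seq (dehomog f)) hs ss s1 => s hs ss s1.
have gE : dehomog (cayley f)
    = \prod_(t <- s) (('i * (1 - t)) *: 'X - (1 + t)%:P).
  by case: hf => z [_ _ _ fE]; move: hs; rewrite fE => hs;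
    apply: dehomog_cayley.
pose u (t : C) : C := 'i * (1 - t); pose phi (t : C) := (1 + t) / u t.
(* The coefficient of X^(n+1) is the product of the [u t]; as it is nonzero, no denominator of [phi]
   vanishes on [s]. *)
rewrite gE -{1}ss (coef_prod_affine _ u) => u0.
have ut t : t \in s -> u t != 0.
  by move: u0; rewrite prodf_seq_neq0 => /allP h /h.
have -> : \prod_(t <- s) (('i * (1 - t)) *: 'X - (1 + t)%:P)
  = (\prod_(t <- s) u t) *: \prod_(x <- map phi s) ('X - x%:P).
  rewrite big_map -scaler_prod; apply: eq_big_seq => t ts.
  rewrite scalerBr -[u t *: _%:P]mul_polyC -polyCM.
  by rewrite [u t * _]mulrC /phi divfK ?ut.
set G := _ *: _.
have sG : size G = n.+2 by rewrite size_scale // size_prod_XsubC size_map ss.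
have lG : lead_coef G = \prod_(t <- s) u t.
  by rewrite lead_coefZ lead_coef_prod_XsubC mulr1.
have := root_seq_XsubC _ _ (map phi s) u0.
(* [s'] orders the t_j so that [phi] maps them to the roots as listed; the power sums do not see the
   order. *)
case/perm_map_lift => s' rG ps.
rewrite /Dis sG lG rG size_map; under eq_mx do rewrite -(perm_big _ ps) /=.
rewrite -(perm_big _ ps) /= in s1; rewrite -(perm_big _ ps) /=.
have ss' : size s' = n.+1 by rewrite (perm_size ps).
rewrite det_power_sums // ss' (big_nth 0) ss' big_mkord /= -muln2 exprM.
rewrite mulnC exprM.
(* By [prod_pairs], each pair j < k receives 4 from the power of 2 and (u_j u_k)^2 from the leading
   coefficient. *)
have -> : 2 ^+ n.+1 = \prod_(j < n.+1) 2 :> C by rewrite prodr_const card_ord.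
rewrite -!prod_pairs.
rewrite -prodrXl -!big_split; apply: eq_bigr => j _.
rewrite -prodrXl -!big_split; apply: eq_bigr => k _ /=.
rewrite !(nth_map 0) ?ss' //.
have uj (i : 'I_n.+1) : u s'`_i != 0.
  by rewrite ut // -(perm_mem ps) mem_nth ?ss'.
have -> : phi s'`_j - phi s'`_k
  = 2 * 'i * (s'`_j - s'`_k) / (u s'`_j * u s'`_k).
  have h1 := uj j; have h2 := uj k; rewrite /phi.
  move: h1 h2; rewrite /u !mulf_eq0 !negb_or => /andP[i0 h1] /andP[_ h2].
  by field; rewrite i0 h1 h2.
rewrite -exprMn mulrCA divff; last first.
  by rewrite mulf_eq0 (negPf (uj j)) (negPf (uj k)).
(* The square of 'i yields the minus sign that each pair carries in [det_power_sums]. *)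
by rewrite mulr1 !exprMn sqrCi; ring.
Qed.

Theorem theorem2p9 (R : realType) (n : nat) (hn : (1 <= n)%N)
    (f : {mpoly R[i][2]}) (hf : MA n f) :
  exists c : 'I_n.+2 -> R,
    cayley f = binary_form (fun j => real_complex R (c j)) /\
    (c ord0 <> 0 ->
     Dis (dehomog (cayley f)) = 2 ^+ (n * n.+1) * \det (Hmx n f)).
Proof.
have homf : cayley f \is n.+1.-homog.
  by case: hf => z [_ _ _ ->]; apply: cayley_homog.
pose m (j : 'I_n.+2) : 'X_{1..2} :=
  (U_(ord0) *+ (n.+1 - j) + U_(ord_max) *+ j)%MM.
(* These coefficients are fixed by conjugation, so taking real parts loses nothing. *)
exists (fun j => complex.Re (cayley f)@_(m j)).
have gE : cayley f =
    binary_form (fun j => real_complex R (complex.Re (cayley f)@_(m j))).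
  rewrite {1}(homog_binary_form _ _ _ homf); apply: eq_bigr => j _.
  congr (_ *: _); symmetry; apply: complex.RRe_real.
  apply/CrealP; rewrite -[RHS](congr1 (mcoeff (m j)) (cayley_MA_conj _ _ _ hf)).
  exact/esym/mcoeff_map_mpoly.
split=> // c0.
have g0 : (dehomog (cayley f))`_n.+1 != 0.
  rewrite gE -[X in _`_X]/(n.+1 - @ord0 n.+1)%N coef_dehomog_binary_form.
  by apply/eqP => /complexI.
exact: Dis_cayley.
Qed.
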